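(* For every $n\ge 1$, $$P_n(w)=\det(wI_{n-1}-J'_{n-1}),\qquad Q_n(w)=\det(wI_n-J_n),$$ $$\widetilde P_n(w)=\det(wI_n-\widetilde J'_n),\qquad \widetilde Q_n(w)=\det(wI_n-\widetilde J_n),$$ where $I_m$ is the identity matrix of size $m$. Consequently, for every $n\ge 1$, as rational functions of $w$, $$\mathbf e_0^*(wI_n-J_n)^{-1}\mathbf e_0=\frac{P_n(w)}{Q_n(w)},\qquad \frac{\mathbf e_0^*(wI_n-\widetilde J_n)^{-1}\mathbf e_0}{\mathbf e_0^*(wI_n-\widetilde J'_n)^{-1}\mathbf e_0}=\frac{\widetilde P_n(w)}{\widetilde Q_n(w)},$$ where $\mathbf e_0$ is the first vector of the canonical basis of $\mathbb C^n$.
   Context: Let $s_0,s_1,\ldots\in\mathbb C$. Define $f_l^k$ ($l\ge -2$, $k\ge 0$) by $f_{-2}^k=f_{-1}^k=\delta_{0,k}$, $f_0^k=s_k$, and $$f_{l+1}^k=\frac{(-1)^l}{f_{l-2}^0}\left[f_l^0f_{l-1}^{k+1}-f_{l-1}^0f_l^{k+1}\right],\quad l\ge 0.$$ Standing assumption: $f_l^0\neq 0$ for all $l\ge 0$. Put $$a_l=(-1)^l\frac{f_l^0}{f_{l-2}^0},\quad b_{l+1}=(-1)^l\frac{f_{l-1}^0}{f_{l-2}^0}\quad (l\ge 0),\qquad r_0=0,\quad r_l=(-1)^{l-1}\frac{f_l^0f_{l-3}^0}{f_{l-2}^0f_{l-1}^0}\quad (l\ge 1).$$ Polynomials $A_k,B_k$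 are defined by $zA_{-2}(z)=1$, $A_{-1}=0$, $A_{k+2}(z)=b_{k+3}A_{k+1}(z)+za_{k+2}A_k(z)$ for $k\ge -2$, and $B_{-2}=0$, $B_{-1}=1$, $B_{k+2}(z)=b_{k+3}B_{k+1}(z)+za_{k+2}B_k(z)$ for $k\ge -2$. Normalized polynomials, for $l\ge -1$: $$\widehat A_l(z)=\frac{A_l(z)}{(-1)^{l(l+1)/2}s_0f_{l-1}^0},\qquad \widehat B_l(z)=\frac{B_l(z)}{(-1)^{l(l+1)/2}f_{l-1}^0}.$$ Monic polynomials, for $n\ge 0$: $$P_n(w)=w^{n-1}\widehat A_{2n-1}(w^{-1}),\ Q_n(w)=w^n\widehat B_{2n-1}(w^{-1}),\ \widetilde P_n(w)=w^n\widehat A_{2n}(w^{-1}),\ \widetilde Q_n(w)=w^n\widehat B_{2n}(w^{-1})$$ (with $P_0=0$). Put $c_0=-r_1$, and for $l\ge 1$: $c_l=-(r_{2l}+r_{2l+1})$, $d_l=r_{2l-1}r_{2l}$, $\tilde c_l=-(r_{2l+2}+r_{2l+1})$, $\tilde d_l=r_{2l+1}r_{2l}$; moreover $\tilde c_0=-r_1-r_2$ and $\tilde c_0'=-r_2$. The matrices are tridiagonal with all superdiagonal entries equal to $1$: - $J_n$ ($n\times n$) has diagonal $c_0,c_1,\dots,c_{n-1}$ and subdiagonal $d_1,\dots,d_{n-1}$; - $J'_{n-1}$ ($(n-1)\times(n-1)$) has diagonal $c_1,\dots,c_{n-1}$ and subdiagonal $d_2,\dots,d_{n-1}$; - $\widetilde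 J_n$ ($n\times n$) has diagonal $\tilde c_0,\tilde c_1,\dots,\tilde c_{n-1}$ and subdiagonal $\tilde d_1,\dots,\tilde d_{n-1}$; - $\widetilde J'_n$ ($n\times n$) has diagonal $\tilde c'_0,\tilde c_1,\dots,\tilde c_{n-1}$ and subdiagonal $\tilde d_1,\dots,\tilde d_{n-1}$. The determinant of the empty ($0\times0$) matrix is $1$. *)

(* Defs.v *)
From mathcomp Require Import all_boot all_order all_algebra.
From mathcomp Require Import reals complex zify.

Set Implicit Arguments.
Unset Strict Implicit.
Unset Printing Implicit Defensive.

Import GRing.Theory.

Local Open Scope ring_scope.

Section ContinuedFraction.

Variables (C : fieldType) (s : nat -> C).

(* [fshift m k] is f_{m-2}^k. *)
Fixpoint fshift (m : nat) : nat -> C :=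
  match m with
  | 0 => fun k => (k == 0%N)%:R
  | p1.+1 => match p1 with
    | 0 => fun k => (k == 0%N)%:R
    | p2.+1 => match p2 with
      | 0 => s
      | l.+1 => fun k =>
          (-1) ^+ l / fshift l 0 *
          (fshift p1 0 * fshift p2 k.+1 - fshift p2 0 * fshift p1 k.+1)
      end
    end
  end.

(* f_l^k, meaningful for l >= -2 only. *)
Definition f (l : int) (k : nat) : C := fshift `|(l + 2)%R|%N k.

Lemma f_rec (l k : nat) :
  f (l%:Z + 1) k =
  (-1) ^+ l / f (l%:Z - 2) 0 *
  (f l 0 * f (l%:Z - 1) k.+1 - f (l%:Z - 1) 0 * f l k.+1).
Proof.
have e3 : (`|(l%:Z + 1 + 2)%R| = l.+3)%N by lia.
have e2 : (`|(l%:Z + 2)%R| = l.+2)%N by lia.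
have e1 : (`|(l%:Z - 1 + 2)%R| = l.+1)%N by lia.
have e0 : (`|(l%:Z - 2 + 2)%R| = l)%N by lia.
by rewrite /f e0 e1 e2 e3.
Qed.

Definition a (l : nat) : C := (-1) ^+ l * (f l 0 / f (l%:Z - 2) 0).

(* b_l is defined for l >= 1; the value at 0 is never used. *)
Definition b (l : nat) : C :=
  if l is m.+1 then (-1) ^+ m * (f (m%:Z - 1) 0 / f (m%:Z - 2) 0) else 0.

Definition r (l : nat) : C :=
  if l is m.+1 then
    (-1) ^+ m * ((f l 0 * f (l%:Z - 3) 0) / (f (l%:Z - 2) 0 * f (l%:Z - 1) 0))
  else 0.

(* [Ashift m] is A_{m-1}. The Laurent polynomial A_{-2} = 1/z only enters
   A_0 = b_1 A_{-1} + a_0 (z A_{-2}), where z A_{-2} = 1. *)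
Fixpoint Ashift (m : nat) : {poly C} :=
  match m with
  | 0 => 0
  | p1.+1 => match p1 with
    | 0 => (b 1)%:P * 0 + (a 0)%:P * 1
    | p.+1 => (b p.+2)%:P * Ashift p1 + 'X * (a p.+1)%:P * Ashift p
    end
  end.

(* [Bshift m] is B_{m-2}. *)
Fixpoint Bshift (m : nat) : {poly C} :=
  match m with
  | 0 => 0
  | p1.+1 => match p1 with
    | 0 => 1
    | p.+1 => (b p.+1)%:P * Bshift p1 + 'X * (a p)%:P * Bshift p
    end
  end.

(* A_l for l >= -1 and B_l for l >= -2. *)
Definition A (l : int) : {poly C} := Ashift `|(l + 1)%R|%N.
Definition B (l : int) : {poly C} := Bshift `|(l + 2)%R|%N.

Definition sgn_tri (l : int) : C := (-1) ^ ((l * (l + 1)) %/ 2)%Z.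

Definition Ahat (l : int) : {poly C} :=
  (sgn_tri l * s 0 * f (l - 1) 0)^-1 *: A l.
Definition Bhat (l : int) : {poly C} :=
  (sgn_tri l * f (l - 1) 0)^-1 *: B l.

(* The field C(w) of rational functions, and its constants. *)
Definition ratfun := {fraction {poly C}}.
Definition cst (x : C) : ratfun := tofrac x%:P.
Definition w : ratfun := tofrac 'X.

(* p(w^{-1}) as a rational function of w. *)
Definition at_winv (p : {poly C}) : ratfun := (map_poly cst p).[w^-1].

Definition P (n : nat) : ratfun := w ^ (n%:Z - 1) * at_winv (Ahat (2 * n%:Z - 1)).
Definition Q (n : nat) : ratfun := w ^ n%:Z * at_winv (Bhat (2 * n%:Z - 1)).
Definition Pt (n : nat) : ratfun := w ^ n%:Z * at_winv (Ahat (2 * n%:Z)).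
Definition Qt (n : nat) : ratfun := w ^ n%:Z * at_winv (Bhat (2 * n%:Z)).

Definition c (l : nat) : C :=
  if l is 0 then - r 1 else - (r (2 * l) + r (2 * l + 1)).
Definition d (l : nat) : C := r (2 * l - 1) * r (2 * l).
Definition ct (l : nat) : C := - (r (2 * l + 2) + r (2 * l + 1)).
Definition dt (l : nat) : C := r (2 * l + 1) * r (2 * l).
Definition ct0' : C := - r 2.

(* Rows and columns are numbered from 0; [sub i] is the entry in row i,
   column i - 1. *)
Definition tridiag (n : nat) (diag sub : nat -> C) : 'M[C]_n :=
  \matrix_(i < n, j < n)
    if i == j then diag i
    else if j == i.+1 :> nat then 1
    else if i == j.+1 :> nat then sub i
    else 0.

Definition J (n : nat) : 'M[C]_n := tridiag n c d.
(* [J' m] is the m x m matrix with diagonal c_1, ..., c_m and subdiagonal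
   d_2, ..., d_m. *)
Definition J' (m : nat) : 'M[C]_m :=
  tridiag m (fun i => c i.+1) (fun i => d i.+1).
Definition Jt (n : nat) : 'M[C]_n := tridiag n ct dt.
Definition Jt' (n : nat) : 'M[C]_n :=
  tridiag n (fun i => if i is 0 then ct0' else ct i) dt.

End ContinuedFraction.

(* w I_n - M over C(w). *)
Definition pencil (C : fieldType) (n : nat) (M : 'M[C]_n) : 'M[ratfun C]_n :=
  (w C)%:M - map_mx (@cst C) M.

Definition e0 (C : fieldType) (n : nat) : 'cV[C]_n :=
  \col_(i < n) (i == 0%N :> nat)%:R.

(* e_0^* (w I_n - M)^{-1} e_0, with e_0^* the conjugate transpose of e_0. *)
Definition m_fun (C : numClosedFieldType) (n : nat) (M : 'M[C]_n) : ratfun C :=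
  (map_mx (@cst C) (map_mx Num.conj (e0 C n))^T *m invmx (pencil M)
     *m map_mx (@cst C) (e0 C n)) 0 0.

(* Main.v *)
From HB Require Import structures.
Require Import Defs.
From mathcomp Require Import all_boot all_order all_algebra.
From mathcomp Require Import reals complex.
From mathcomp Require Import ring zify.

(** The normalization turns both recurrences into
    [V_l = V_(l-1) + r_l z V_(l-2)] for [l >= 1] ([normalize_rec]); the sequence
    [s] survives only through the numbers [r_l]. After [z = 1/w] and
    multiplication by powers of [w], the odd and even terms
    [E_n = w^n V_(2n-1)(1/w)] and [O_n = w^n V_(2n)(1/w)] satisfy

      [E_(n+1) = w O_n + r_(2n+1) E_n],  [O_(n+1) = E_(n+1) + r_(2n+2) O_n].

    Eliminating one family from this pair of two-term relations leaves a
    three-term recurrence for the other ([even_contraction],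
    [odd_contraction]), whose coefficients are exactly the entries [c, d] of
    [J] for [E] and the entries [ct, dt] of [Jt] for [O]. The determinants
    [det (w I_n - M)] of tridiagonal [M] satisfy the same recurrence
    ([det_tridiagonal_rec]), so each of the four identities reduces to a
    comparison of two initial values. [P] and [Q], and likewise [Pt] and [Qt],
    solve the same recurrence with different initial values; for [P] the
    initial value [P_0 = 0] shifts the indices by one, which yields the
    truncated matrix [J'].

    For the resolvents, Cramer's rule gives the first entry of
    [(w I_n - M)^-1] as the quotient of the determinant with the first row and
    column deleted by the full one ([m_fun_det]). Deleting them from [J n] gives
    [J' n.-1]; deleting them from [Jt n] and [Jt' n] gives the same matrix, since
    these two differ in their first diagonal entry only. *)

Import GRing.Theory.

Set Implicit Arguments.
Unset Strict Implicit.

Local Open Scope ring_scope.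

(** * Three-term recurrences *)

(** Stated for an infinite array, so that every leading principal minor is
    visibly of the same kind: expansion along the last row, then along the last
    column of the off-diagonal cofactor, only meets such minors. *)
Lemma det_tridiagonal_rec (R : comNzRingType) (T : nat -> nat -> R)
    (T0 : forall i j, (i.+1 < j)%N || (j.+1 < i)%N -> T i j = 0) (n : nat) :
  \det (\matrix_(i < n.+2, j < n.+2) T i j) =
  T n.+1 n.+1 * \det (\matrix_(i < n.+1, j < n.+1) T i j)
  - T n.+1 n * T n n.+1 * \det (\matrix_(i < n, j < n) T i j).
Proof.
rewrite (expand_det_row _ ord_max) big_ord_recr big_ord_recr /=.
rewrite big1 ?add0r; last first.
  by move=> i _; rewrite mxE T0 ?mul0r //= ltnS ltn_ord orbT.
rewrite !mxE /= addrC; congr (_ + _).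
  rewrite /cofactor /= addnn -signr_odd odd_double mul1r.
  congr (_ * \det _); apply/matrixP => i j.
  by rewrite !mxE !lift_max.
rewrite /cofactor /= addSn addnn -signr_odd /= odd_double /= expr1 mulN1r mulrN.
congr (- _); rewrite -mulrA; congr (_ * _).
rewrite (expand_det_col _ ord_max) big_ord_recr /=.
rewrite big1 ?add0r; last first.
  move=> i _; rewrite !mxE T0 ?mul0r //=.
  by have := ltn_ord i; rewrite /bump leqnn; lia.
rewrite !mxE /= /cofactor /= addnn -signr_odd odd_double mul1r.
rewrite /bump ltnn leqnn add0n add1n.
congr (_ * \det _); apply/matrixP => i j; rewrite !mxE !lift_max /=.
by congr T; rewrite /bump /=; have := ltn_ord j; lia.
Qed.

Lemma three_term_unique (R : pzRingType) (al be x y : nat -> R) :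
    (forall n, x n.+2 = al n * x n.+1 - be n * x n) ->
    (forall n, y n.+2 = al n * y n.+1 - be n * y n) ->
  x 0%N = y 0%N -> x 1%N = y 1%N -> x =1 y.
Proof.
move=> hx hy h0 h1 n; suff []: x n = y n /\ x n.+1 = y n.+1 by [].
by elim: n => // n [IH IH1]; split=> //; rewrite hx hy IH IH1.
Qed.

Section Contraction.
Variables (K : comNzRingType) (v : K) (rho E O : nat -> K).
Hypothesis E_step : forall n, E n.+1 = v * O n + rho (2 * n).+1 * E n.
Hypothesis O_step : forall n, O n.+1 = E n.+1 + rho (2 * n).+2 * O n.

(** [v O_n] is eliminated by means of [E_step] at index [n]. *)
Lemma even_contraction n :
  E n.+2 = (v + (rho (2 * n).+2 + rho (2 * n).+3)) * E n.+1
           - rho (2 * n).+1 * rho (2 * n).+2 * E n.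
Proof.
rewrite E_step O_step; have -> : (2 * n.+1)%N = (2 * n).+2 by lia.
have -> : v * (E n.+1 + rho (2 * n).+2 * O n) =
    v * E n.+1 + rho (2 * n).+2 * (E n.+1 - rho (2 * n).+1 * E n).
  by rewrite (E_step n); ring.
ring.
Qed.

(** [E_(n+1)] is eliminated by means of [O_step] at index [n]. *)
Lemma odd_contraction n :
  O n.+2 = (v + (rho (2 * n).+4 + rho (2 * n).+3)) * O n.+1
           - rho (2 * n).+3 * rho (2 * n).+2 * O n.
Proof.
rewrite O_step E_step; have -> : (2 * n.+1)%N = (2 * n).+2 by lia.
have -> : E n.+1 = O n.+1 - rho (2 * n).+2 * O n by rewrite O_step addrK.
ring.
Qed.

End Contraction.

(** * Determinants of pencils *)

Section Pencil.
Variable C : fieldType.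

HB.instance Definition _ :=
  GRing.RMorphism.copy (@cst C) (@tofrac {poly C} \o @polyC C).

Lemma w_neq0 : w C != 0.
Proof. by rewrite tofrac_eq0 polyX_eq0. Qed.

(** This identification gives the invertibility of every pencil: the
    characteristic polynomial is monic. *)
Lemma det_pencil_char_poly n (M : 'M[C]_n) :
  \det (pencil M) = tofrac (char_poly M).
Proof.
rewrite /char_poly -det_map_mx; congr (\det _); apply/matrixP => i j.
by rewrite !mxE rmorphB rmorphMn.
Qed.

Lemma det_pencil_neq0 n (M : 'M[C]_n) : \det (pencil M) != 0.
Proof.
by rewrite det_pencil_char_poly tofrac_eq0 monic_neq0 ?char_poly_monic.
Qed.

Lemma det_pencil_tridiag0 diag sub : \det (pencil (@tridiag C 0 diag sub)) = 1.
Proof. exact: det_mx00. Qed.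

Lemma det_pencil_tridiag1 diag sub :
  \det (pencil (@tridiag C 1 diag sub)) = w C - cst (diag 0%N).
Proof. by rewrite det_mx11 !mxE. Qed.

Lemma det_pencil_tridiag_rec diag sub n :
  \det (pencil (@tridiag C n.+2 diag sub)) =
  (w C - cst (diag n.+1)) * \det (pencil (@tridiag C n.+1 diag sub))
  - cst (sub n.+1) * \det (pencil (@tridiag C n diag sub)).
Proof.
pose T i j : ratfun C := (w C) *+ (i == j) -
  cst (if i == j then diag i else if j == i.+1 then 1
       else if i == j.+1 then sub i else 0).
have TE m : pencil (@tridiag C m diag sub) = \matrix_(i < m, j < m) T i j.
  by apply/matrixP => i j; rewrite !mxE.
rewrite !TE det_tridiagonal_rec; last first.
  move=> i j ij; rewrite /T.
  have [-> -> ->] : [/\ i == j = false, j == i.+1 = false & i == j.+1 = false].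
    by split; lia.
  by rewrite rmorph0 subr0.
have nS : (n.+1 == n) = false by lia.
have Sn : (n == n.+1) = false by lia.
have nSS : (n == n.+2) = false by lia.
rewrite /T !eqxx nS Sn nSS mulr0n !sub0r rmorph1 mulrN1 opprK.
by rewrite mulr1n.
Qed.

End Pencil.

Section MFun.
Variable C : numClosedFieldType.

(** Cramer's rule for the first entry of the inverse. *)
Lemma m_fun_det (n : nat) (M : 'M[C]_n.+1) :
  m_fun M = \det (pencil (row' ord0 (col' ord0 M))) / \det (pencil M).
Proof.
have -> : m_fun M = invmx (pencil M) ord0 ord0.
  rewrite /m_fun !mxE big_ord_recl big1 ?addr0; last first.
    by move=> i _; rewrite !mxE /= rmorph0 mulr0.
  rewrite !mxE rmorph1 mulr1 big_ord_recl big1 ?addr0; last first.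
    by move=> i _; rewrite !mxE /= !rmorph0 mul0r.
  by rewrite !mxE /= !rmorph1 mul1r.
rewrite /invmx unitmxE unitfE det_pencil_neq0 !mxE mulrC /cofactor mul1r.
congr (\det _ / _); apply/matrixP => i j; rewrite !mxE.
by rewrite (inj_eq lift_inj).
Qed.

Lemma drop_tridiag n diag sub :
  row' ord0 (col' ord0 (@tridiag C n.+1 diag sub))
  = tridiag n (fun i => diag i.+1) (fun i => sub i.+1).
Proof. by apply/matrixP => i j; rewrite !mxE (inj_eq lift_inj). Qed.

End MFun.

(** * Normalization of the continued fraction *)

Section Recurrences.
Variables (C : fieldType) (s : nat -> C).
Hypothesis hf : forall l : nat, f s l 0 != 0.

Lemma fshift_neq0 m : fshift s m 0 != 0.
Proof.
case: m => [|[|l]]; try exact: oner_neq0.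
have := hf l; rewrite /f; have -> // : `|(l%:Z + 2)%R|%N = l.+2 by lia.
Qed.

Lemma sgn_tri_pred (m : nat) : sgn_tri C m = (-1) ^+ m * sgn_tri C (m%:Z - 1).
Proof.
rewrite /sgn_tri -[(-1) ^+ m]/((-1) ^ m%:Z) -expfzDr ?oppr_eq0 ?oner_eq0 //.
by congr (_ ^ _); rewrite -divzMDl //; congr (_ %/ _)%Z; ring.
Qed.

Lemma sgn_tri_neq0 l : sgn_tri C l != 0.
Proof. by rewrite expfz_neq0 // oppr_eq0 oner_eq0. Qed.

Lemma sgn_triN1 : sgn_tri C (0%:Z - 1) = 1.
Proof. by []. Qed.

Lemma sgn_tri0 : sgn_tri C (1%:Z - 1) = 1.
Proof. by []. Qed.

(** The factor common to the normalizations of [A_l] and [B_l]; here and below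
    a sequence that starts at [l = -1] is indexed by [m = l + 1]. *)
Definition normalize (U : nat -> {poly C}) m : {poly C} :=
  (sgn_tri C (m%:Z - 1) * fshift s m 0)^-1 *: U m.

(** With [N_l] the normalizing factor, [b_(l+1) N_(l-1) / N_l = 1] and
    [a_l N_(l-2) / N_l = r_l]; the triangular signs supply
    [N_l / N_(l-1) = (-1)^l f_(l-1) / f_(l-2)]. *)
Lemma normalize_rec (U : nat -> {poly C}) :
    (forall m, U m.+2 = (b s m.+2)%:P * U m.+1 + 'X * (a s m.+1)%:P * U m) ->
  forall m,
    normalize U m.+2 = normalize U m.+1 + r s m.+1 *: ('X * normalize U m).
Proof.
move=> hU m; rewrite /normalize hU.
have -> : (b s m.+2)%:P * U m.+1 + 'X * (a s m.+1)%:P * U m =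
    b s m.+2 *: U m.+1 + a s m.+1 *: ('X * U m).
  by rewrite -!mul_polyC; ring.
rewrite scalerDr -scalerAr !scalerA.
have -> : m.+2%:Z - 1 = m.+1 :> int by lia.
have -> : m.+1%:Z - 1 = m :> int by lia.
rewrite (sgn_tri_pred m.+1); have -> : m.+1%:Z - 1 = m :> int by lia.
rewrite (sgn_tri_pred m) /r /a /b /f.
have -> : `|(m.+1%:Z + 2)%R|%N = m.+3 by lia.
have -> : `|(m.+1%:Z - 3 + 2)%R|%N = m by lia.
have -> : `|(m.+1%:Z - 2 + 2)%R|%N = m.+1 by lia.
have -> : `|(m.+1%:Z - 1 + 2)%R|%N = m.+2 by lia.
have h0 := fshift_neq0 m; have h1 := fshift_neq0 m.+1.
have h2 := fshift_neq0 m.+2.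
have hg := sgn_tri_neq0 (m%:Z - 1).
rewrite [(-1) ^+ m.+1]exprS.
move: (fshift s m 0) (fshift s m.+1 0) (fshift s m.+2 0) (fshift s m.+3 0)
  h0 h1 h2.
move: (sgn_tri C _) hg => g hg e0 e1 e2 e3 h0 h1 h2.
have [->|->] : (-1) ^+ m = 1 :> C \/ (-1) ^+ m = -1 :> C.
- by rewrite -signr_odd; case: odd; [right|left].
- by congr (_ *: _ + _ *: _); field;
    rewrite ?h0 ?h1 ?h2 ?hg ?oppr_eq0 ?oner_eq0.
- by congr (_ *: _ + _ *: _); field;
    rewrite ?h0 ?h1 ?h2 ?hg ?oppr_eq0 ?oner_eq0.
Qed.

Definition Bhat_seq m := Bhat s (m%:Z - 1).
Definition Ahat_seq m := Ahat s (m%:Z - 1).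

Lemma Bhat_seqE m : Bhat_seq m = normalize (fun k => Bshift s k.+1) m.
Proof.
rewrite /Bhat_seq /Bhat /normalize /B /f.
have -> : `|(m%:Z - 1 - 1 + 2)%R|%N = m by lia.
by have -> : `|(m%:Z - 1 + 2)%R|%N = m.+1 by lia.
Qed.

Lemma Ahat_seqE m : Ahat_seq m = (s 0%N)^-1 *: normalize (Ashift s) m.
Proof.
rewrite /Ahat_seq /Ahat /normalize /A /f scalerA.
have -> : `|(m%:Z - 1 - 1 + 2)%R|%N = m by lia.
have -> : `|(m%:Z - 1 + 1)%R|%N = m by lia.
by rewrite -invfM; congr (_^-1 *: _); ring.
Qed.

Lemma Bhat_seq_rec m :
  Bhat_seq m.+2 = Bhat_seq m.+1 + r s m.+1 *: ('X * Bhat_seq m).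
Proof. by rewrite !Bhat_seqE; exact: normalize_rec. Qed.

Lemma Ahat_seq_rec m :
  Ahat_seq m.+2 = Ahat_seq m.+1 + r s m.+1 *: ('X * Ahat_seq m).
Proof.
rewrite !Ahat_seqE normalize_rec // scalerDr -[in RHS]scalerAr !scalerA.
by rewrite [_ * r _ _]mulrC.
Qed.

Lemma Bhat_seq0 : Bhat_seq 0 = 1.
Proof. by rewrite Bhat_seqE /normalize sgn_triN1 /= mulr1 invr1 scale1r. Qed.

Lemma Bhat_seq1 : Bhat_seq 1 = 1.
Proof.
rewrite Bhat_seqE /normalize sgn_tri0 /= /f /=.
by rewrite divr1 !mulr1 mulr0 addr0 invr1 scale1r.
Qed.

Lemma Ahat_seq0 : Ahat_seq 0 = 0.
Proof. by rewrite Ahat_seqE /normalize /= !scaler0. Qed.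

Lemma Ahat_seq1 : Ahat_seq 1 = 1.
Proof.
have s0 : s 0%N != 0 := hf 0.
rewrite Ahat_seqE /normalize sgn_tri0 /= /a /f /= mulr0 add0r.
rewrite divr1 expr0 !mul1r mulr1 invr1 scale1r -mul_polyC -polyCM.
by rewrite mulVf.
Qed.

(** * Even and odd parts after the substitution z = 1/w *)

Lemma at_winvD (p q : {poly C}) : at_winv (p + q) = at_winv p + at_winv q.
Proof. by rewrite /at_winv rmorphD hornerD. Qed.

Lemma at_winvZ x (p : {poly C}) : at_winv (x *: p) = cst x * at_winv p.
Proof. by rewrite /at_winv map_polyZ hornerZ. Qed.

Lemma at_winvXM (p : {poly C}) : at_winv ('X * p) = (w C)^-1 * at_winv p.
Proof.
by rewrite /at_winv rmorphM /= map_polyX [in LHS]mulrC hornerMX mulrC.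
Qed.

Lemma at_winvC x : at_winv (x%:P : {poly C}) = cst x.
Proof. by rewrite /at_winv map_polyC hornerC. Qed.

Definition even_part (V : nat -> {poly C}) n : ratfun C :=
  w C ^+ n * at_winv (V (2 * n)%N).
Definition odd_part (V : nat -> {poly C}) n : ratfun C :=
  w C ^+ n * at_winv (V (2 * n).+1).

Section EvenOdd.
Variable V : nat -> {poly C}.
Hypothesis hV : forall m, V m.+2 = V m.+1 + r s m.+1 *: ('X * V m).

Lemma even_step n :
  even_part V n.+1 =
  w C * odd_part V n + cst (r s (2 * n).+1) * even_part V n.
Proof.
rewrite /even_part /odd_part; have -> : (2 * n.+1)%N = (2 * n).+2 by lia.
rewrite hV at_winvD at_winvZ at_winvXM mulrDr exprS -mulrA; congr (_ + _).
rewrite mulrCA; congr (_ * _).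
by rewrite [w C * _]mulrC -mulrA mulVKf ?w_neq0.
Qed.

Lemma odd_step n :
  odd_part V n.+1 =
  even_part V n.+1 + cst (r s (2 * n).+2) * odd_part V n.
Proof.
rewrite /even_part /odd_part; have -> : (2 * n.+1)%N = (2 * n).+2 by lia.
rewrite hV at_winvD at_winvZ at_winvXM mulrDr; congr (_ + _).
rewrite mulrCA; congr (_ * _).
by rewrite exprSr -mulrA mulVKf ?w_neq0.
Qed.

Lemma even_rec n :
  even_part V n.+2 =
  (w C - cst (c s n.+1)) * even_part V n.+1 - cst (d s n.+1) * even_part V n.
Proof.
rewrite (even_contraction (rho := fun l => cst (r s l)) even_step odd_step).
rewrite /c /d; have -> : (2 * n.+1)%N = (2 * n).+2 by lia.
by rewrite addn1 subn1 succnK rmorphN rmorphD [cst (_ * _)]rmorphM opprK.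
Qed.

Lemma odd_rec n :
  odd_part V n.+2 =
  (w C - cst (ct s n.+1)) * odd_part V n.+1 - cst (dt s n.+1) * odd_part V n.
Proof.
rewrite (odd_contraction (rho := fun l => cst (r s l)) even_step odd_step).
rewrite /ct /dt; have -> : (2 * n.+1)%N = (2 * n).+2 by lia.
by rewrite addn2 addn1 rmorphN rmorphD [cst (_ * _)]rmorphM opprK.
Qed.

End EvenOdd.

(** * The four families as determinants *)

Lemma QE n : Q s n = even_part Bhat_seq n.
Proof. by rewrite /Q /even_part /Bhat_seq PoszM. Qed.

Lemma QtE n : Qt s n = odd_part Bhat_seq n.
Proof.
by rewrite /Qt /odd_part /Bhat_seq; congr (_ * at_winv (Bhat s _)); lia.
Qed.

Lemma PtE n : Pt s n = odd_part Ahat_seq n.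
Proof.
by rewrite /Pt /odd_part /Ahat_seq; congr (_ * at_winv (Ahat s _)); lia.
Qed.

Lemma PE n : P s n = (w C)^-1 * even_part Ahat_seq n.
Proof.
rewrite /P /even_part /Ahat_seq PoszM mulrA; congr (_ * _).
by rewrite addrC expfzDr ?w_neq0.
Qed.

Lemma Q_det n : Q s n = \det (pencil (J s n)).
Proof.
rewrite QE; move: n.
apply: three_term_unique (even_rec Bhat_seq_rec) (det_pencil_tridiag_rec _ _) _ _.
  by rewrite det_pencil_tridiag0 /even_part Bhat_seq0 at_winvC rmorph1 mulr1.
rewrite det_pencil_tridiag1 (even_step Bhat_seq_rec) /even_part /odd_part.
rewrite Bhat_seq0 Bhat_seq1 at_winvC !rmorph1.
by rewrite !mulr1 rmorphN opprK.
Qed.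

Lemma Qt_det n : Qt s n = \det (pencil (Jt s n)).
Proof.
rewrite QtE; move: n.
apply: three_term_unique (odd_rec Bhat_seq_rec) (det_pencil_tridiag_rec _ _) _ _.
  by rewrite det_pencil_tridiag0 /odd_part Bhat_seq1 at_winvC rmorph1 mulr1.
rewrite det_pencil_tridiag1 (odd_step Bhat_seq_rec) (even_step Bhat_seq_rec).
rewrite /even_part /odd_part Bhat_seq0 Bhat_seq1 at_winvC !rmorph1 !mulr1.
by rewrite rmorphN rmorphD opprK -addrA [cst _ + _]addrC.
Qed.

(** The term [r_1] of [Qt_1] is multiplied here by [Ahat_(-1) = 0], hence the
    corner entry [- r_2] instead of [- r_1 - r_2]. *)
Lemma Pt_det n : Pt s n = \det (pencil (Jt' s n)).
Proof.
have D_rec m : \det (pencil (Jt' s m.+2)) =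
    (w C - cst (ct s m.+1)) * \det (pencil (Jt' s m.+1))
    - cst (dt s m.+1) * \det (pencil (Jt' s m)).
  exact: det_pencil_tridiag_rec.
rewrite PtE; move: n; apply: three_term_unique (odd_rec Ahat_seq_rec) D_rec _ _.
  by rewrite det_pencil_tridiag0 /odd_part Ahat_seq1 at_winvC rmorph1 mulr1.
rewrite det_pencil_tridiag1 (odd_step Ahat_seq_rec) (even_step Ahat_seq_rec).
rewrite /even_part /odd_part Ahat_seq0 Ahat_seq1 !at_winvC rmorph0 rmorph1.
by rewrite !mulr0 addr0 !mulr1 rmorphN opprK.
Qed.

(** Since [P_0 = 0] and [P_1 = 1], the shifted sequence [P_(n+1)] is the one
    that starts like a continuant, with coefficients shifted accordingly. *)
Lemma P_det n : P s n.+1 = \det (pencil (J' s n)).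
Proof.
have P0 : P s 0 = 0.
  by rewrite PE /even_part Ahat_seq0 at_winvC rmorph0 !mulr0.
have P1 : P s 1 = 1.
  rewrite PE (even_step Ahat_seq_rec) /even_part /odd_part.
  rewrite Ahat_seq0 Ahat_seq1 !at_winvC rmorph0 rmorph1.
  by rewrite !mulr0 addr0 !mulr1 mulVf ?w_neq0.
have P_rec m : P s m.+2 =
    (w C - cst (c s m.+1)) * P s m.+1 - cst (d s m.+1) * P s m.
  rewrite !PE (even_rec Ahat_seq_rec) mulrBr.
  by congr (_ - _); rewrite mulrCA.
move: n.
apply: three_term_unique (fun m => P_rec m.+1) (det_pencil_tridiag_rec _ _) _ _.
  by rewrite det_pencil_tridiag0.
by rewrite det_pencil_tridiag1 P_rec P0 P1 mulr0 subr0 mulr1.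
Qed.

End Recurrences.

Theorem theorem6 (R : realType) (s : nat -> R[i])
    (hf : forall l : nat, f s l 0 != 0) (n : nat) (hn : (1 <= n)%N) :
  [/\ P s n = \det (pencil (J' s n.-1)),
      Q s n = \det (pencil (J s n)),
      Pt s n = \det (pencil (Jt' s n)) &
      Qt s n = \det (pencil (Jt s n))] /\
  (m_fun (J s n) = P s n / Q s n /\
   m_fun (Jt s n) / m_fun (Jt' s n) = Pt s n / Qt s n).
Proof.
case: n hn => // n _; rewrite P_det // Q_det // Pt_det // Qt_det //.
split; first by [].
split; first by rewrite m_fun_det /J drop_tridiag.
rewrite !m_fun_det /Jt /Jt' !drop_tridiag.
(* Both numerators are convertible to this determinant, so they cancel. *)
by rewrite invf_div mulrC mulrA divfK ?det_pencil_neq0.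
Qed.
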